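(* The following equalities of classes hold: $$\begin{aligned}\mathbb{K}_{\mathbf{CPL}_{\mathbf e}}&=\{\mathcal{B}\in\mathbb{K}_{\mathbf{Ci}}:\mathcal{M}(\mathcal{B})\text{ validates }(\mathbf{cons})\}\\&=\{\mathcal{B}\in\mathbb{K}_{\mathbf{mbC}}:\mathcal{M}(\mathcal{B})\text{ validates }(\mathbf{cons})\}\\&=\{\mathcal{B}\in\mathbb{K}_{\mathbf{CPL}^+_{\mathbf e}}:\mathcal{M}(\mathcal{B})\text{ validates }(\mathbf{Ax10}),(\mathbf{bc1})\text{ and }(\mathbf{cons})\}.\end{aligned}$$
   Context: Let $\Sigma=\{\wedge,\vee,\to,\neg,\circ\}$ ($\neg,\circ$ unary, the others binary); $For(\Sigma)$ is the set of formulas over $\Sigma$ generated by a denumerable set of propositional variables. A multialgebra over $\Sigma$ is a nonempty set with operations whose values are nonempty subsets. For a Boolean algebra $\mathcal{A}$ with domain $A$ (the one-element Boolean algebra is allowed) and $z\in A^3$ write $z=(z_1,z_2,z_3)$; $\sim$ is Boolean complement. A swap structure for $\mathbf{CPL}^+_{\mathbf e}$ over $\mathcal{A}$ is a multialgebra $\mathcal{B}$ over $\Sigma$ with domain $|\mathcal{B}|=B\subseteq A^3$ such that $0\in\{z_1:z\in B\}$ and for all $z,w\in B$: $\emptyset\ne z\#w\subseteq\{u\in B: u_1=z_1\# w_1\}$ for $\#\in\{\wedge,\vee,\to\}$; $\emptyset\neq\neg z\subseteq\{u\in B:u_1=z_2\}$; $\emptyset\ne\circ z\subseteq\{u\in B:u_1=z_3\}$.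 $\mathbb{K}_{\mathbf{CPL}^+_{\mathbf e}}$ is the class of all of these, over arbitrary Boolean algebras. $\mathbb{K}_{\mathbf{mbC}}$ consists of those with $B\subseteq\{z\in A^3: z_1\vee z_2=1,\ z_1\wedge z_2\wedge z_3=0\}$. $\mathbb{K}_{\mathbf{Ci}}$ consists of those with $B\subseteq\{z\in A^3: z_1\vee z_2=1,\ z_3={\sim}(z_1\wedge z_2)\}$ such that for all $z\in B$: $\circ z=\{({\sim}(z_1\wedge z_2),z_1\wedge z_2,1)\}$ and $\neg z\subseteq\{u\in B:u_1=z_2\text{ and }u_2\le z_1\}$. $\mathbb{K}_{\mathbf{CPL}_{\mathbf e}}$ consists of those $\mathcal{B}\in\mathbb{K}_{\mathbf{Ci}}$ with $B\subseteq\{(a,{\sim}a,1):a\in A\}$. $\mathcal{M}(\mathcal{B})=(\mathcal{B},D_{\mathcal{B}})$ is the Nmatrix with designated set $D_{\mathcal{B}}=\{z\in B: z_1=1\}$. A valuation over $\mathcal{M}(\mathcal{B})$ is $v:For(\Sigma)\to B$ with $v(\alpha\#\beta)\in v(\alpha)\#v(\beta)$, $v(\neg\alpha)\in\neg v(\alpha)$, $v(\circ\alpha)\in\circ v(\alpha)$. $\mathcal{M}(\mathcal{B})$ validates an axiom schema if $v(\gamma)\in D_{\mathcal{B}}$ for every instance $\gamma$ and every valuation $v$. The schemas are: $(\mathbf{Ax10})$ $\alpha\vee\neg\alpha$; $(\mathbf{bc1})$ $\circ\alpha\to(\alpha\to(\neg\alpha\to\beta))$; $(\mathbf{cons})$ $\circ\alpha$.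 *)

(* Defs.v *)
From mathcomp Require Import all_boot all_order.
From mathcomp Require Import boolp classical_sets.

Set Implicit Arguments.
Unset Strict Implicit.
Unset Printing Implicit Defensive.

Import Order.TTheory.

Local Open Scope classical_set_scope.
Local Open Scope order_scope.

Inductive binary_connective := Conj | Disj | Impl.
Inductive unary_connective := Neg | Circ.

Inductive formula :=
| Var of nat
| Bin of binary_connective & formula & formula
| Un of unary_connective & formula.

Record multialgebra (X : Type) := Multialgebra {
  mbin : binary_connective -> X -> X -> set X;
  mun : unary_connective -> X -> set X;
  multialgebra_dom_neq0 : inhabited X;
  mbin_neq0 : forall c x y, mbin c x y !=set0;
  mun_neq0 : forall c x, mun c x !=set0 }.

Record Nmatrix := MkNmatrix {
  nm_dom : Type;
  nm_alg : multialgebra nm_dom;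
  designated : set nm_dom }.

Definition valuation (M : Nmatrix) (v : formula -> nm_dom M) : Prop :=
  (forall c a b, mbin (nm_alg M) c (v a) (v b) (v (Bin c a b))) /\
  (forall c a, mun (nm_alg M) c (v a) (v (Un c a))).

(* An axiom schema is given by the set of its instances. *)
Definition validates (M : Nmatrix) (S : set formula) : Prop :=
  forall g, S g ->
  forall v : formula -> nm_dom M, valuation v -> designated (v g).

Definition Ax10 : set formula :=
  [set g | exists a, g = Bin Disj a (Un Neg a)].

Definition bc1 : set formula :=
  [set g | exists a b,
     g = Bin Impl (Un Circ a) (Bin Impl a (Bin Impl (Un Neg a) b))].

Definition cons_schema : set formula :=
  [set g | exists a, g = Un Circ a].

(* Boolean algebras are the complemented distributive lattices with top and
   bottom of the order library, at any display; these axioms do not exclude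
   \bot = \top. *)
Section Triples.
Context {d : Order.disp_t} {A : ctbDistrLatticeType d}.

Definition coord1 (z : A * A * A) : A := z.1.1.
Definition coord2 (z : A * A * A) : A := z.1.2.
Definition coord3 (z : A * A * A) : A := z.2.

Definition boolean_op (c : binary_connective) (x y : A) : A :=
  match c with
  | Conj => x `&` y
  | Disj => x `|` y
  | Impl => ~` x `|` y
  end.
End Triples.

(* A multialgebra whose domain is a set of triples over a Boolean algebra.
   The Boolean algebra is part of the data, because membership in the classes
   below and the designated set both refer to it. *)
Record triple_multialgebra := TripleMultialgebra {
  tm_disp : Order.disp_t;
  tm_bool : ctbDistrLatticeType tm_disp;
  tm_dom : set (tm_bool * tm_bool * tm_bool);
  tm_alg : multialgebra tm_dom }.

Arguments tm_dom : clear implicits.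

(* [set triple_multialgebra] is not well-typed: MathComp-Analysis instantiates
   Boolean algebras with types [set T], so the type of all Boolean algebras lies
   in a universe above the arguments of [set]. *)
Definition triple_multialgebra_class := triple_multialgebra -> Prop.

Definition Nmatrix_of (B : triple_multialgebra) : Nmatrix :=
  MkNmatrix (tm_alg B) [set z | coord1 (val z) = \top].

Definition K_CPLpe : triple_multialgebra_class := fun B =>
  [/\ exists z : tm_dom B, coord1 (val z) = \bot,
      forall c (z w : tm_dom B), mbin (tm_alg B) c z w `<=`
        [set u | coord1 (val u) = boolean_op c (coord1 (val z)) (coord1 (val w))],
      forall z : tm_dom B, mun (tm_alg B) Neg z `<=`
        [set u | coord1 (val u) = coord2 (val z)] &
      forall z : tm_dom B, mun (tm_alg B) Circ z `<=`
        [set u | coord1 (val u) = coord3 (val z)]].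

Definition K_mbC : triple_multialgebra_class := fun B =>
  K_CPLpe B /\
  tm_dom B `<=` [set z | coord1 z `|` coord2 z = \top /\
                         coord1 z `&` coord2 z `&` coord3 z = \bot].

Definition K_Ci : triple_multialgebra_class := fun B =>
  [/\ K_CPLpe B,
      tm_dom B `<=` [set z | coord1 z `|` coord2 z = \top /\
                             coord3 z = ~` (coord1 z `&` coord2 z)],
      forall z : tm_dom B, val @` mun (tm_alg B) Circ z =
        [set (~` (coord1 (val z) `&` coord2 (val z)),
              coord1 (val z) `&` coord2 (val z), \top)] &
      forall z : tm_dom B, mun (tm_alg B) Neg z `<=`
        [set u | coord1 (val u) = coord2 (val z) /\
                 coord2 (val u) <= coord1 (val z)]].

Definition K_CPLe : triple_multialgebra_class := fun B =>
  K_Ci B /\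
  tm_dom B `<=` [set (a, ~` a, \top) | a in [set: tm_bool B]].

(* Main.v *)
Require Import Defs.
From mathcomp Require Import all_boot all_order.
From mathcomp Require Import boolp classical_sets.

(** Every assignment of values to the variables extends to a
valuation, so the validity of a schema on an Nmatrix becomes a pointwise
condition on the triples: (cons) says that the third coordinate is the top
element, (Ax10) that the join of the first two is, and (bc1), read at a value of
[b] whose first coordinate is the bottom element, that the meet of the three
coordinates is the bottom element. Under (cons) the snapshots of a structure
for mbC are thus of the form [(a, ~a, 1)], so the only available value for
[circ z] is [(1, 0, 1)]. *)

Set Implicit Arguments.
Unset Strict Implicit.
Unset Printing Implicit Defensive.

Import Order.Theory.

Local Open Scope classical_set_scope.
Local Open Scope order_scope.

Fixpoint extend_valuation (M : Nmatrix) (f : nat -> nm_dom M) (g : formula) :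
    nm_dom M :=
  match g with
  | Var n => f n
  | Bin c a b =>
      sval (cid (mbin_neq0 (nm_alg M) c (extend_valuation f a)
                                        (extend_valuation f b)))
  | Un c a => sval (cid (mun_neq0 (nm_alg M) c (extend_valuation f a)))
  end.

Lemma extend_valuationP (M : Nmatrix) (f : nat -> nm_dom M) :
  valuation (extend_valuation f).
Proof. by split=> [c a b|c a] /=; case: cid. Qed.

(** Disjointness gives [y <= ~x]; by De Morgan, the join being top makes [~x] and [~y] disjoint,
    hence [~x <= y]. *)
Lemma compl_unique (d : Order.disp_t) (A : ctbDistrLatticeType d) (x y : A) :
  x `|` y = \top -> x `&` y = \bot -> y = ~` x.
Proof.
move=> xy1 /eqP; rewrite disj_leC lexC => y_le; apply/le_anti; rewrite y_le /=.
by rewrite -[leRHS]complK -disj_leC -complU xy1 compl1.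
Qed.

Section SwapStructure.
Variable B : triple_multialgebra.
Hypothesis KB : K_CPLpe B.
Implicit Types (z : tm_dom B) (v : formula -> tm_dom B).

Lemma coord1_bin v c a b : @valuation (Nmatrix_of B) v ->
  coord1 (val (v (Bin c a b))) =
  boolean_op c (coord1 (val (v a))) (coord1 (val (v b))).
Proof. by case: KB => _ + _ _ [+ _]; move=> H Hv; exact: H (Hv c a b). Qed.

Lemma coord1_neg v a : @valuation (Nmatrix_of B) v ->
  coord1 (val (v (Un Neg a))) = coord2 (val (v a)).
Proof. by case: KB => _ _ + _ [_ +]; move=> H Hv; exact: H (Hv Neg a). Qed.

Lemma coord1_circ v a : @valuation (Nmatrix_of B) v ->
  coord1 (val (v (Un Circ a))) = coord3 (val (v a)).
Proof. by case: KB => _ _ _ + [_ +]; move=> H Hv; exact: H (Hv Circ a). Qed.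

Lemma validates_consP : validates (Nmatrix_of B) cons_schema <->
  forall z, coord3 (val z) = \top.
Proof.
split=> [H z|H _ [a ->] v Hv] /=; last by rewrite coord1_circ.
(* The schema has a single metavariable, so a constant assignment is enough to make it take the
   value [z]. *)
have Hv := extend_valuationP (M := Nmatrix_of B) (fun=> z).
by rewrite -(H _ (ex_intro _ (Var 0) erefl) _ Hv) (coord1_circ _ Hv).
Qed.

Lemma validates_Ax10P : validates (Nmatrix_of B) Ax10 <->
  forall z, coord1 (val z) `|` coord2 (val z) = \top.
Proof.
split=> [H z|H _ [a ->] v Hv] /=; last first.
  by rewrite coord1_bin //= coord1_neg //; exact: H.
have Hv := extend_valuationP (M := Nmatrix_of B) (fun=> z).
rewrite -(H _ (ex_intro _ (Var 0) erefl) _ Hv).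
by rewrite (coord1_bin _ _ _ Hv) (coord1_neg _ Hv).
Qed.

Lemma validates_bc1P : validates (Nmatrix_of B) bc1 <->
  forall z, coord1 (val z) `&` coord2 (val z) `&` coord3 (val z) = \bot.
Proof.
(* Each implication is a join with a complement, so De Morgan gathers the three nested premises into
   one complemented meet. *)
have E v a b : @valuation (Nmatrix_of B) v ->
    coord1 (val (v (Bin Impl (Un Circ a) (Bin Impl a (Bin Impl (Un Neg a) b)))))
  = ~` (coord1 (val (v a)) `&` coord2 (val (v a)) `&` coord3 (val (v a)))
    `|` coord1 (val (v b)).
  move=> Hv; rewrite !coord1_bin //= coord1_circ // coord1_neg //.
  by rewrite !complI -!joinA joinCA; congr (_ `|` _); exact: joinCA.
split=> [H z|H _ [a [b ->]] v Hv] /=; last by rewrite E // H compl0 join1x.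
have [[z0 z00] _ _ _] := KB.
(* [Var 0] stands for the first metavariable and gets [z]; [Var 1] gets [z0], whose bottom first
   coordinate drops out of the join in [E]. *)
have Hv := extend_valuationP (M := Nmatrix_of B)
  (fun n => if n is 0 then z else z0).
have := esym (E _ (Var 0) (Var 1) Hv).
rewrite (H _ (ex_intro _ _ (ex_intro _ _ erefl)) _ Hv) /= z00 joinx0 => z1.
by rewrite -[LHS]complK z1 compl1.
Qed.
End SwapStructure.

Lemma snapshot_eta (d : Order.disp_t) (A : ctbDistrLatticeType d)
  (z : A * A * A) : z = (coord1 z, coord2 z, coord3 z).
Proof. by case: z => -[]. Qed.

Lemma K_CPLe_Ci_cons B :
  K_CPLe B <-> K_Ci B /\ validates (Nmatrix_of B) cons_schema.
Proof.
split=> -[KCi H]; split=> //; have [KB dom _ _] := KCi.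
  apply/validates_consP => // z.
  by have [a _ <-] := H _ (set_valP z).
move=> z Bz; have [z1 z3] := dom _ Bz.
have /= z3T := (validates_consP KB).1 H (SigSub (mem_set Bz)).
(* In Ci the third coordinate is the complement of the meet of the first two; as it is top, that
   meet is bottom and the second coordinate is the complement of the first. *)
exists (coord1 z) => //; rewrite [RHS]snapshot_eta z3T -(compl_unique z1) //.
by rewrite -[LHS]complK -z3 z3T compl1.
Qed.

Lemma K_Ci_mbC B : K_Ci B -> K_mbC B.
Proof.
case=> KB dom _ _; split=> // z /dom[z1 z3]; split=> //.
by rewrite z3 meetxC.
Qed.

Lemma K_mbC_cons_Ci B :
  K_mbC B -> validates (Nmatrix_of B) cons_schema -> K_Ci B.
Proof.
move=> [KB dom] /(validates_consP KB) z3.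
have join12 z : tm_dom B z -> coord1 z `|` coord2 z = \top by case/dom.
have meet12 z : tm_dom B z -> coord1 z `&` coord2 z = \bot.
  move=> Bz; have [_] := dom _ Bz.
  by have /= -> := z3 (SigSub (mem_set Bz)); rewrite meetx1.
have z2 (z : tm_dom B) : coord2 (val z) = ~` coord1 (val z).
  by apply: compl_unique; [apply: join12|apply: meet12]; exact: set_valP.
have [_ _ Hneg Hcirc] := KB.
split=> // [z Bz|z|z u /Hneg /= u1].
- split; first exact: join12.
  by rewrite meet12 // compl0; exact: z3 (SigSub (mem_set Bz)).
- rewrite meet12 ?compl0; last exact: set_valP.
  have circE (u : tm_dom B) : mun (tm_alg B) Circ z u ->
      val u = (\top, \bot, \top).
    by move=> /Hcirc /= u1; rewrite [LHS]snapshot_eta z2 u1 !z3 compl1.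
  (* [circE] gives only inclusion in the singleton; equality follows because the value of [Circ] is
     nonempty. *)
  apply/seteqP; split=> [_ [u /circE -> <-//]|_ ->].
  by have [u Hu] := mun_neq0 (tm_alg B) Circ z; exists u => //; exact: circE.
(* The inequality is an equality here: [u2 = ~u1 = ~z2 = ~~z1 = z1]. *)
- by split=> //; rewrite z2 u1 z2 complK.
Qed.

(** Read pointwise, the two schemas are exactly the two conditions that mbC puts on the domain. *)
Lemma K_mbC_validates B :
  K_mbC B <-> [/\ K_CPLpe B, validates (Nmatrix_of B) Ax10 &
                  validates (Nmatrix_of B) bc1].
Proof.
split=> [[KB dom]|[KB]].
  split=> //; [apply/validates_Ax10P|apply/validates_bc1P] => // z;
    by have [] := dom _ (set_valP z).
move=> /(validates_Ax10P KB) H1 /(validates_bc1P KB) H2; split=> // z Bz.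
by split; [exact: H1 (SigSub (mem_set Bz))|exact: H2 (SigSub (mem_set Bz))].
Qed.

Theorem proposition8p18 :
  [/\ K_CPLe = (fun B => K_Ci B /\ validates (Nmatrix_of B) cons_schema),
      (fun B => K_Ci B /\ validates (Nmatrix_of B) cons_schema) =
      (fun B => K_mbC B /\ validates (Nmatrix_of B) cons_schema) &
      (fun B => K_mbC B /\ validates (Nmatrix_of B) cons_schema) =
      (fun B => [/\ K_CPLpe B, validates (Nmatrix_of B) Ax10,
                   validates (Nmatrix_of B) bc1 &
                   validates (Nmatrix_of B) cons_schema])].
Proof.
split; apply: functional_extensionality_dep => B; apply: propext.
- exact: K_CPLe_Ci_cons.
- split=> -[KB Hc]; split=> //; first exact: K_Ci_mbC.
  exact: K_mbC_cons_Ci.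
- split=> [[/K_mbC_validates[]]//|[KB H1 H2 Hc]].
  by split=> //; apply/K_mbC_validates.
Qed.
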